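(* Let $X$ be a singular toric Calabi-Yau threefold without compact $4$-cycles whose toric diagram is the strip $C_{m,n}$ with a set of interior edges filled in, cutting it from left to right into subdiagrams $C_1,\dots,C_P$ of shapes $C_{m_k,n_k}$, where $(m,n)=\sum_{k=1}^P(m_k,n_k)$. Put $b_k=\prod_{j\ne k}\binom{m_j+n_j}{n_j}$. Then the total partition function of $X$ factors as $$Z'_{\mathrm{tot}}(X;-q,Q)=Z''(-q,Q)\prod_{k=1}^{P}Z'_{\mathrm{tot}}(C_{m_k,n_k};-q,Q)^{b_k}.$$ For each $k$ with $m_k+n_k\ge2$, the factor $Z'_{\mathrm{tot}}(C_{m_k,n_k};-q,Q)$ is homogeneous of degree $$d_k=\frac{(m_k^2-m_k+n_k^2-n_k-2m_kn_k)(m_k+n_k-2)!}{m_k!\,n_k!},$$ and $Z''$ is a product of integer powers of factors $M(Q_{ij},q)$ only for pairs $i\le j$ such that the edge path $\{i,i+1,\dots,j\}$ corresponding to $Q_{ij}$ crosses (i.e. contains the index of) at least one of the filled-in interior edges of the toric diagram of $X$.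
   Context: **Strip and triangulations.** For integers $m,n\ge0$, not both $0$, the strip $C_{m,n}$ is the lattice trapezoid with vertices $(0,0),(0,1),(m,1),(n,0)$ (the same name denotes the toric variety $xy=z^mw^n$ in $\mathbb{C}^4$ it defines). Consider maximal lattice triangulations (all triangles of area $1/2$). Each triangle has exactly one horizontal side, its base, on the top line (height $1$) or the bottom line (height $0$). Triangles are numbered $t_1,\dots,t_{m+n}$ from left to right, and a triangulation is recorded by the subset $T\subset\{1,\dots,m+n\}$, $|T|=m$, of indices of triangles with base on the top line; every such subset occurs. The interior edges are $e_i=t_i\cap t_{i+1}$, $1\le i\le m+n-1$; put $\tau_T(e_i)=+1$ if $t_i,t_{i+1}$ have bases on the same line and $-1$ otherwise. **Partition functions.** $Q_1,\dots,Q_{m+n-1}$ are formal variables, $Q_i$ corresponding to the edge $e_i$ in every triangulation; $Q_{ij}=Q_iQ_{i+1}\cdots Q_j$; $M(x,q)=\prod_{k\ge1}(1-xq^k)^{-k}$. An edge path is a set $\{i,i+1,\dots,j\}$ with $1\le i\le j\le m+n-1$. The reduced Donaldson--Thomas partition function of the crepant resolution given by $T$ is $$Z'_T(C_{m,n};-q,Q)=\prod_{1\le i\le j\le m+n-1}M(Q_{ij},q)^{\tau_T(e_i)\cdots\tau_T(e_j)},$$ and $Z'_{\mathrm{tot}}(C_{m,n};-q,Q)=\prod_{T}Z'_T(C_{m,n};-q,Q)$ over all $T$ with $|T|=m$. **The variety $X$.** The toric diagram of $X$ is the strip $C_{m,n}$ with an arbitrary set of $P-1$ non-crossing interior lattice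 edges, each joining a point of the top line to a point of the bottom line, filled in (equivalently there is a birational map $X\to C_{m,n}$ which is a partial crepant resolution). The filled edges cut the strip from left to right into $P$ trapezoids or triangles; the $k$-th one, $C_k$, has top side of length $m_k$ and bottom side of length $n_k$, $(m_k,n_k)\ne(0,0)$. With $N_k=\sum_{l\le k}(m_l+n_l)$, $N_0=0$, the filled edges are the interior edges $e_{N_1},\dots,e_{N_{P-1}}$ in every triangulation containing them. The total partition function of $X$ is $Z'_{\mathrm{tot}}(X;-q,Q)=\prod_TZ'_T(C_{m,n};-q,Q)$, the product being only over those triangulations $T$ of $C_{m,n}$ which correspond to resolutions of $X$, i.e. which contain all the filled edges. **Variables of the subdiagrams.** In $Z'_{\mathrm{tot}}(C_{m_k,n_k};-q,Q)$ the formal variables are those of the interior edges of $C_k$, namely $Q_i$ with $N_{k-1}<i<N_k$ in this order (the factor is $1$ if $m_k+n_k=1$). **Homogeneity.** A partition function $Z(q,Q)$ is homogeneous of degree $d$ if $Z(q,Q)=\bigl(\prod_A M(\prod_{i\in A}Q_i,q)\bigr)^d$, the product over $A$ running over some finite collection of index sets $A$. *)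

(* Defs.v *)
From HB Require Import structures.
From mathcomp Require Import all_boot all_order all_algebra.
From mathcomp Require Import boolp.
From mathcomp Require Import mpoly.

Set Implicit Arguments.
Unset Strict Implicit.
Unset Printing Implicit Defensive.

Import GRing.Theory.
Local Open Scope ring_scope.

(** * Formal power series in [q] over a commutative ring *)

Record fps (A : comNzRingType) := Fps { fcoef :> nat -> A }.

(* Equality of power series is not decidable; eqType and choiceType come from
   the classical axioms of [boolp]. *)
HB.instance Definition _ (A : comNzRingType) := gen_eqMixin (fps A).
HB.instance Definition _ (A : comNzRingType) := gen_choiceMixin (fps A).

Section PowerSeries.
Variable A : comNzRingType.
Implicit Types s t u : fps A.

Lemma fpsP s t : (forall d, s d = t d) -> s = t.
Proof. by case: s t => [s] [t] /= st; congr Fps; apply/funext. Qed.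

Definition fps_zero : fps A := Fps (fun _ => 0).
Definition fps_opp s : fps A := Fps (fun d => - s d).
Definition fps_add s t : fps A := Fps (fun d => s d + t d).
Definition fps_one : fps A := Fps (fun d => (d == 0)%:R).
Definition fps_mul s t : fps A :=
  Fps (fun d => \sum_(i < d.+1) s i * t (d - i)%N).

Fact fps_addA : associative fps_add.
Proof. by move=> s t u; apply: fpsP => d /=; rewrite addrA. Qed.
Fact fps_addC : commutative fps_add.
Proof. by move=> s t; apply: fpsP => d /=; rewrite addrC. Qed.
Fact fps_add0 : left_id fps_zero fps_add.
Proof. by move=> s; apply: fpsP => d /=; rewrite add0r. Qed.
Fact fps_addN : left_inverse fps_zero fps_opp fps_add.
Proof. by move=> s; apply: fpsP => d /=; rewrite addNr. Qed.

HB.instance Definition _ :=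
  GRing.isZmodule.Build (fps A) fps_addA fps_addC fps_add0 fps_addN.

Fact fps_mulC : commutative fps_mul.
Proof.
move=> s t; apply: fpsP => d /=.
rewrite (reindex_inj rev_ord_inj) /=; apply: eq_bigr => i _.
by rewrite subSS mulrC subKn // -ltnS.
Qed.

Fact fps_mulA : associative fps_mul.
Proof.
move=> s t u; rewrite [fps_mul s t]fps_mulC; apply: fpsP => d.
have rev v w e : fps_mul v w e = \sum_(i < e.+1) v (e - i)%N * w i.
  by rewrite fps_mulC /=; apply: eq_bigr => i _; rewrite mulrC.
pose c3 j k := s j * (t (d - j - k)%N * u k).
rewrite [RHS]rev [LHS]/=.
transitivity (\sum_(j < d.+1) \sum_(k < d.+1 | (k <= d - j)%N) c3 j k).
  apply: eq_bigr => /= j _; rewrite -[X in _ * X]/(fps_mul t u (d - j)%N) rev big_distrr /=.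
  by rewrite (big_ord_narrow_leq (leq_subr _ _)).
rewrite (exchange_big_dep predT) //=; apply: eq_bigr => k _.
transitivity (\sum_(j < d.+1 | (j <= d - k)%N) c3 j k).
  apply: eq_bigl => j; rewrite -ltnS -(ltnS j) -!subSn ?leq_ord //.
  by rewrite -subn_gt0 -(subn_gt0 j) -!subnDA addnC.
rewrite (big_ord_narrow_leq (leq_subr _ _)).
rewrite -[X in X * _]/(fps_mul t s (d - k)%N) fps_mulC big_distrl /=.
by apply: eq_bigr => j _; rewrite /c3 -!subnDA addnC mulrA.
Qed.

Fact fps_mul1 : left_id fps_one fps_mul.
Proof.
move=> s; apply: fpsP => d /=.
by rewrite big_ord_recl subn0 mul1r big1 ?addr0 // => i _; rewrite mul0r.
Qed.

Fact fps_mulDl : left_distributive fps_mul +%R.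
Proof.
move=> s t u; apply: fpsP => d /=; rewrite -big_split.
by apply: eq_bigr => i _; rewrite mulrDl.
Qed.

Fact fps_one_neq0 : fps_one != 0.
Proof. by apply/eqP => /(congr1 (fun s => s 0%N)) /eqP; rewrite oner_eq0. Qed.

HB.instance Definition _ := GRing.Zmodule_isComNzRing.Build (fps A)
  fps_mulA fps_mulC fps_mul1 fps_mulDl fps_one_neq0.

(* The inverse is the inverse of the ring whenever one exists; by
   [fps_unit_coef0] below, it exists for every series that is inverted here. *)
Definition fps_unit : pred (fps A) := fun s => `[< exists t, t * s = 1 >].
Definition fps_inv s : fps A :=
  if pselect (exists t, t * s = 1) is left h then projT1 (cid h) else s.

Fact fps_mulVr : {in fps_unit, left_inverse 1 fps_inv *%R}.
Proof.
move=> s /asboolP us; rewrite /fps_inv; case: pselect => // h.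
exact: projT2 (cid h).
Qed.
Fact fps_unitP s t : t * s = 1 -> fps_unit s.
Proof. by move=> ts; apply/asboolP; exists t. Qed.
Fact fps_inv_out : {in [predC fps_unit], fps_inv =1 id}.
Proof.
by move=> s /asboolPn us; rewrite /fps_inv; case: pselect.
Qed.

HB.instance Definition _ := GRing.ComNzRing_hasMulInverse.Build (fps A)
  fps_mulVr fps_unitP fps_inv_out.

Lemma fps_coef0 d : (0 : fps A) d = 0. Proof. by []. Qed.
Lemma fps_coef1 d : (1 : fps A) d = (d == 0)%:R. Proof. by []. Qed.
Lemma fps_coefD s t d : (s + t) d = s d + t d. Proof. by []. Qed.
Lemma fps_coefN s d : (- s) d = - s d. Proof. by []. Qed.
Lemma fps_coefM s t d : (s * t) d = \sum_(i < d.+1) s i * t (d - i)%N.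
Proof. by []. Qed.

(* Congruence modulo [q ^ n]. *)
Definition fps_eqmod n s t := forall d, (d < n)%N -> s d = t d.

Lemma fps_eqmodM n s s' t t' :
  fps_eqmod n s s' -> fps_eqmod n t t' -> fps_eqmod n (s * t) (s' * t').
Proof.
move=> ss tt d dn; rewrite !fps_coefM; apply: eq_bigr => i _.
rewrite ss ?tt //; first exact: leq_ltn_trans (leq_subr _ _) dn.
by apply: leq_ltn_trans dn; rewrite -ltnS.
Qed.

Lemma fps_expr_lt s k d : s 0%N = 0 -> (d < k)%N -> (s ^+ k) d = 0.
Proof.
move=> s0; elim: k d => // k IHk d dk; rewrite exprS fps_coefM big1 // => i _.
case: (posnP i) => [-> | i0]; first by rewrite s0 mul0r.
rewrite IHk ?mulr0 //; apply: leq_trans (dk : d <= k)%N.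
by rewrite ltn_subrL i0 (leq_trans i0) // -ltnS.
Qed.

Lemma fps_unit_coef0 s : s 0%N = 1 -> s \is a GRing.unit.
Proof.
move=> s1; pose f := 1 - s.
have f0 : f 0%N = 0 by rewrite fps_coefD fps_coefN s1 fps_coef1 subrr.
pose g n := \sum_(k < n) f ^+ k.
have gE n : g n * s = 1 - f ^+ n.
  have -> : s = 1 - f by rewrite opprB addrC subrK.
  by rewrite -[RHS]opprB subrX1 -mulNr [in RHS]opprB mulrC.
have gS d n : (d < n)%N -> g n d = g d.+1 d.
  elim: n => // n IHn; rewrite ltnS leq_eqVlt => /predU1P[-> // | dn].
  by rewrite -IHn // /g big_ord_recr fps_coefD fps_expr_lt // addr0.
suff E : Fps (fun d => g d.+1 d) * s = 1.
  by apply/unitrPr; exists (Fps (fun d => g d.+1 d)); rewrite mulrC.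
apply: fpsP => d.
transitivity ((g d.+1 * s) d).
  by apply: (@fps_eqmodM d.+1) (ltnSn d) => // e ed; rewrite (gS e d.+1).
by rewrite gE fps_coefD fps_coefN fps_expr_lt // subr0.
Qed.

(** * The MacMahon-type factor [M(x, q) = prod_(k >= 1) (1 - x q^k)^(-k)] *)

(* [fps_monom x k] is [x q^k]. *)
Definition fps_monom (x : A) (k : nat) : fps A := Fps (fun d => x *+ (d == k)).

Definition Mpartial (x : A) (N : nat) : fps A :=
  \prod_(1 <= k < N.+1) ((1 - fps_monom x k)^-1 ^+ k).

(* The coefficient of [q ^ d] in the partial products is constant from the
   [d]-th on ([M_coef]), so this is their limit. *)
Definition M (x : A) : fps A := Fps (fun d => Mpartial x d d).

Lemma fps_coef_monom x k d : fps_monom x k d = x *+ (d == k). Proof. by []. Qed.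

Lemma one_sub_monom_unit x k :
  (0 < k)%N -> 1 - fps_monom x k \is a GRing.unit.
Proof.
move=> k0; apply: fps_unit_coef0.
by rewrite fps_coefD fps_coefN fps_coef_monom (ltn_eqF k0) oppr0 addr0.
Qed.

Lemma M_coef x N d : (d <= N)%N -> M x d = Mpartial x N d.
Proof.
elim: N => [|N IHN]; first by rewrite leqn0 => /eqP ->.
rewrite leq_eqVlt => /predU1P[-> // | dN]; rewrite IHN // /Mpartial.
rewrite [in RHS]big_nat_recr //= -[in LHS](mulr1 (\prod_(_ <= _ < _) _)).
have I : fps_eqmod N.+1 1 (1 - fps_monom x N.+1)^-1.
  rewrite -[X in fps_eqmod _ X _](mulVr (one_sub_monom_unit x (ltn0Sn N))).
  rewrite -[X in fps_eqmod _ _ X]mulr1.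
  apply: fps_eqmodM => // e eN.
  by rewrite fps_coefD fps_coefN fps_coef_monom ltn_eqF // oppr0 addr0.
have F k : fps_eqmod N.+1 1 ((1 - fps_monom x N.+1)^-1 ^+ k).
  elim: k => // k IHk; rewrite exprS -[X in fps_eqmod _ X _]mulr1.
  exact: fps_eqmodM.
exact: (fps_eqmodM _ (F N.+1)).
Qed.

Lemma M_unit x : M x \is a GRing.unit.
Proof. by apply: fps_unit_coef0; rewrite /= /Mpartial big_geq. Qed.

End PowerSeries.

(** * Triangulations of the strip [C_{m,n}] and their partition functions *)

(* Triangles and interior edges are numbered from 1 as [t_1, ..., t_(m+n)] and
   [e_1, ..., e_(m+n-1)]; a triangulation is the set [T] of the triangles with
   base on the top line, [t_j] being encoded by the ordinal of value [j - 1]. *)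
Definition on_top (N : nat) (T : {set 'I_N}) (j : nat) : bool :=
  [exists t in T, t.+1 == j].

Definition tau (N : nat) (T : {set 'I_N}) (i : nat) : int :=
  if on_top T i == on_top T i.+1 then 1 else -1.

(* [(a, b)] stands for the segment joining [(a, 1)] to [(b, 0)]. *)
Definition ledge := (nat * nat)%type.

(* To the left of [e_i] lie [t_1, ..., t_i], whose bases cover the top line up
   to abscissa [a] and the bottom line up to abscissa [b]. *)
Definition tri_edge (N : nat) (T : {set 'I_N}) (i : nat) : ledge :=
  (#|[set t in T | (t < i)%N]|, #|[set t in ~: T | (t < i)%N]|).

Section PartitionFunctions.
Variables (A : comNzRingType) (Q : nat -> A).

Definition Qpath (i j : nat) : A := \prod_(i <= l < j.+1) Q l.

(* All the series in [q] below are the partition functions at [-q]: for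
   instance [Zred m n T] is [Z'_T(C_{m,n}; -q, Q)]. *)
Definition Zred (m n : nat) (T : {set 'I_(m + n)}) : fps A :=
  \prod_(1 <= i < m + n) \prod_(i <= j < m + n)
    M (Qpath i j) ^ (\prod_(i <= l < j.+1) tau T l).

Definition Ztot (m n : nat) : fps A :=
  \prod_(T : {set 'I_(m + n)} | #|T| == m) Zred T.

End PartitionFunctions.

(* [Z] is homogeneous of degree [d] in the variables [Q 1, ..., Q r]; the
   variable [Q l] is encoded by the ordinal of value [l - 1]. *)
Definition homogeneous (A : comNzRingType) (r : nat) (Q : nat -> A)
    (d : int) (Z : fps A) : Prop :=
  exists S : {set {set 'I_r}},
    Z = (\prod_(B in S) M (\prod_(l in B) Q l.+1)) ^ d.

(** * Partial resolutions: strips with some interior edges filled in *)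

Definition crossing (e f : ledge) : bool :=
  ((e.1 < f.1) && (f.2 < e.2))%N || ((f.1 < e.1) && (e.2 < f.2))%N.

Definition lattice_edge (m n : nat) (e : 'I_m.+1 * 'I_n.+1) : ledge :=
  (val e.1, val e.2).

(* [(0, 0)] and [(m, n)] are the left and right sides of the strip. *)
Definition toric_diagram (m n : nat) (E : {set 'I_m.+1 * 'I_n.+1}) : Prop :=
  (forall e, e \in E -> lattice_edge e != (0, 0)%N /\ lattice_edge e != (m, n))
  /\ (forall e f, e \in E -> f \in E ->
        ~~ crossing (lattice_edge e) (lattice_edge f)).

Section Subdiagrams.
Variables (m n : nat) (E : {set 'I_m.+1 * 'I_n.+1}).

(* The left side, the filled edges from left to right, and the right side;
   non-crossing edges are ordered from left to right by [a + b]. *)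
Definition cuts : seq ledge :=
  (0, 0)%N ::
  rcons (sort (fun e f : ledge => (e.1 + e.2 <= f.1 + f.2)%N)
              [seq lattice_edge e | e <- enum E]) (m, n).

Definition npieces : nat := #|E|.+1.

(* Lengths of the top and bottom sides of the pieces, numbered from 0. *)
Definition mtop (k : nat) : nat :=
  ((nth (0, 0)%N cuts k.+1).1 - (nth (0, 0)%N cuts k).1)%N.
Definition nbot (k : nat) : nat :=
  ((nth (0, 0)%N cuts k.+1).2 - (nth (0, 0)%N cuts k).2)%N.

Definition Nsum (k : nat) : nat := (\sum_(l < k) (mtop l + nbot l))%N.

(* The unimodular pieces are the triangles of area 1/2. *)
Definition singular_diagram : Prop :=
  exists k : 'I_npieces, (2 <= mtop k + nbot k)%N.

Definition contains_edge (T : {set 'I_(m + n)}) (e : ledge) : bool :=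
  [exists i : 'I_(m + n), (0 < i)%N && (tri_edge T i == e)].

Definition resolves (T : {set 'I_(m + n)}) : bool :=
  [forall e in E, contains_edge T (lattice_edge e)].

Definition ZtotX (A : comNzRingType) (Q : nat -> A) : fps A :=
  \prod_(T : {set 'I_(m + n)} | (#|T| == m) && resolves T) Zred Q T.

Definition bexp (k : 'I_npieces) : nat :=
  (\prod_(j < npieces | j != k) 'C(mtop j + nbot j, nbot j))%N.

(* The filled edges are [e_(Nsum 1), ..., e_(Nsum (npieces - 1))]. *)
Definition crosses (i j : nat) : bool :=
  has (fun k => i <= Nsum k <= j)%N (iota 1 npieces.-1).

End Subdiagrams.

Definition degree (m n : nat) : rat :=
  (m%:R ^+ 2 - m%:R + n%:R ^+ 2 - n%:R - 2 * m%:R * n%:R) * (m + n - 2)`!%:R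
  / (m`!%:R * n`!%:R).

(** * The formal variables *)

(* [Qvar r l] is the [l]-th of [r] variables for [1 <= l <= r]; other values of
   [l] are never used. *)
Definition Qvar (r l : nat) : {mpoly int[r]} :=
  if insub l.-1 is Some o then 'X_(o : 'I_r) else 0.

(* Main.v *)
Require Import Defs.
From HB Require Import structures.
From mathcomp Require Import all_boot all_order all_algebra.
From mathcomp Require Import boolp.
From mathcomp Require Import mpoly.
From mathcomp Require Import fingroup perm zify ring.
Set Implicit Arguments.
Unset Strict Implicit.
Unset Printing Implicit Defensive.
Import GRing.Theory Num.Theory.
Local Open Scope ring_scope.

(** In the total partition function the exponent of [M(Q_ij, q)] is the sum over
    the allowed triangulations of the product of the signs [tau] along the path
    from [e_i] to [e_j].  That product telescopes: it is [+1] if the triangles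
    [t_i] and [t_(j+1)] at the two ends have their bases on the same line, and
    [-1] otherwise ([prod_tau]).  So each exponent is a signed count of subsets,
    depending only on how the subset treats two given elements.

    For the whole strip the allowed subsets are all those with [m] elements.
    By symmetry the signed count is then the same for every pair of distinct
    elements ([pair_sum_const]), hence the same for every edge path: this is
    homogeneity, the collection of index sets being that of all intervals.  The
    degree follows by adding up over all pairs, since the sum of all the signs of
    a subset of size [m] is [m - n] ([pair_sum_eq], [edge_sum_degree]).

    For [X] the allowed subsets are those whose trace on the [k]-th block of
    consecutive triangles has [m_k] elements, for every [k] ([resolvesE]); the
    traces are chosen independently.  A path which crosses no filled edge has
    both end triangles in one block [k], so its exponent is the one for
    [C_(m_k, n_k)] multiplied by the number [b_k] of choices of the other traces
    ([sum_blocks], [resolution_sum_piece]).  Collecting these paths block by block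
    ([prod_pieces]) yields the product of the partition functions of the pieces,
    and the remaining paths constitute [Z'']. *)

(** * Subsets of fixed size and pairs of signs *)

Definition side (U : finType) (A : {set U}) (x : U) : int :=
  if x \in A then 1 else -1.

Definition pair_sum (U : finType) (r : nat) (x y : U) : int :=
  \sum_(A : {set U} | #|A| == r) side A x * side A y.

Section PairSums.
Variable U : finType.
Implicit Types (A : {set U}) (x y : U) (r : nat).

Lemma side_sqr A x : side A x * side A x = 1.
Proof. by rewrite /side; case: ifP. Qed.

Lemma sum_side A : \sum_x side A x = #|A|%:Z - #|~: A|%:Z.
Proof.
rewrite (bigID (mem A)) /=; congr (_ + _).
  under eq_bigr => x xA do rewrite /side xA.
  by rewrite sumr_const natz.
under eq_bigr => x xA do rewrite /side (negbTE xA).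
rewrite sumrN; congr (- _).
rewrite sumr_const natz; congr Posz.
by apply: eq_card => x; rewrite !inE.
Qed.

Lemma side_imset (V : finType) (h : U -> V) A x :
  injective h -> side (h @: A) (h x) = side A x.
Proof. by move=> h_inj; rewrite /side mem_imset. Qed.

Lemma sum_subsets_imset (V : finType) (h : U -> V) r (F : {set V} -> int) :
  injective h ->
  \sum_(A : {set V} | (A \subset h @: setT) && (#|A| == r)) F A =
  \sum_(A : {set U} | #|A| == r) F (h @: A).
Proof.
move=> h_inj.
rewrite (reindex_onto (fun A : {set U} => h @: A)
                      (fun A : {set V} => h @^-1: A)) /=.
  apply: eq_bigl => A; rewrite imsetS ?subsetT // card_imset //=.
  suff -> : h @^-1: (h @: A) = A by rewrite eqxx andbT.
  by apply/setP => x; rewrite inE mem_imset.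
move=> A /andP[/subsetP Ah _]; apply/setP => y; apply/imsetP/idP.
  by case=> x; rewrite inE => hxA ->.
move=> yA; have /imsetP[x _ yE] := Ah y yA.
by exists x; rewrite // inE -yE.
Qed.

Lemma pair_sum_imset (V : finType) (h : U -> V) r x y :
  injective h ->
  \sum_(A : {set V} | (A \subset h @: setT) && (#|A| == r))
    side A (h x) * side A (h y) = pair_sum r x y.
Proof.
move=> h_inj; rewrite sum_subsets_imset //.
by apply: eq_bigr => A _; rewrite !side_imset.
Qed.

(** The symmetric group is transitive on ordered pairs of distinct points. *)
Lemma pair_sum_const r x y x' y' :
  x != y -> x' != y' -> pair_sum r x y = pair_sum r x' y'.
Proof.
move=> xy xy'; pose z := tperm x x' y.
pose h := (tperm x x' * tperm z y')%g.
have zx : z != x' by rewrite /z -{2}(tpermL x x') (inj_eq perm_inj) eq_sym.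
have hx : h x = x' by rewrite permM tpermL tpermD // eq_sym.
have hy : h y = y' by rewrite permM tpermL.
rewrite -(pair_sum_imset r x y (@perm_inj _ h)) hx hy; apply: eq_bigl => A.
suff -> : h @: setT = setT by rewrite subsetT.
by apply/setP => u; rewrite inE -(permKV h u) mem_imset ?inE //; apply: perm_inj.
Qed.

(** Summing over all ordered pairs of distinct points replaces the count of
    subsets with prescribed signs at two points by the square of the sum of all
    the signs, which depends only on the size of the subset. *)
Lemma pair_sum_eq r x y : x != y ->
  (#|U| * #|U|.-1)%N%:Z * pair_sum r x y =
  'C(#|U|, r)%:Z * ((r%:Z - (#|U|%:Z - r%:Z)) ^+ 2 - #|U|%:Z).
Proof.
move=> xy.
transitivity (\sum_(u : U) \sum_(v | v != u) pair_sum r u v).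
  transitivity (\sum_(u : U) pair_sum r x y *+ #|U|.-1).
    by rewrite sumr_const -mulrnA mulnC -mulr_natl natz.
  apply: eq_bigr => u _; rewrite -(cardC1 u) -sumr_const.
  apply: eq_bigr => v; rewrite inE => vu.
  by apply: pair_sum_const; rewrite // eq_sym.
rewrite /pair_sum.
under eq_bigr => u _ do rewrite exchange_big /=.
rewrite exchange_big /=.
transitivity (\sum_(A : {set U} | #|A| == r)
    ((r%:Z - (#|U|%:Z - r%:Z)) ^+ 2 - #|U|%:Z)).
  apply: eq_bigr => A /eqP Ar.
  have -> : r%:Z - (#|U|%:Z - r%:Z) = \sum_u side A u.
    by rewrite sum_side -(cardsC A) Ar PoszD; ring.
  rewrite expr2 big_distrl /=.
  have -> : #|U|%:Z = \sum_(u : U) side A u * side A u.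
    under [RHS]eq_bigr => u _ do rewrite side_sqr.
    by rewrite sumr_const natz.
  rewrite -sumrB; apply: eq_bigr => u _.
  by rewrite [in RHS](bigD1 u) //= mulrDr addrC addKr big_distrr.
rewrite sumr_const -mulr_natl; congr (_ * _).
rewrite natz -[#|U|]cardsT -cards_draws; congr Posz.
by apply: eq_card => A; rewrite inE subsetT.
Qed.

End PairSums.

(** * Partition functions as products over edge paths *)

Section PathSigns.
Variable N : nat.
Implicit Types (T : {set 'I_N}) (x y : 'I_N).

Lemma on_topE T x : on_top T x.+1 = (x \in T).
Proof.
apply/existsP/idP => [[y /andP[yT]] | xT]; last by exists x; rewrite xT eqxx.
by rewrite eqSS => /eqP/val_inj <-.
Qed.

(** The signs of the interior edges telescope along an edge path: the product
    only remembers the two triangles at the ends of the path. *)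
Lemma prod_tau T x y : (x < y)%N ->
  \prod_(x.+1 <= l < y.+1) tau T l = side T x * side T y.
Proof.
case: y => [y yN] /=; elim: y yN => // y IHy yN xy.
have yN' := ltnW yN.
have tauE : tau T y.+1 = side T (Ordinal yN') * side T (Ordinal yN).
  rewrite /tau -[y.+1]/((Ordinal yN').+1) on_topE.
  rewrite -[(Ordinal yN').+2]/((Ordinal yN).+1) on_topE /side.
  by case: ifP; do 2 case: ifP.
rewrite big_nat_recr //= tauE; move: xy; rewrite ltnS leq_eqVlt.
case/predU1P => [xy | xy]; last first.
  by rewrite (IHy yN') // -mulrA [X in _ * X]mulrA side_sqr mul1r.
rewrite big_geq ?xy // mul1r; congr (side T _ * _); exact/val_inj.
Qed.

End PathSigns.

Section Products.
Variables (A : comNzRingType) (Q : nat -> A).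
Implicit Types (m n : nat).

Lemma prod_exprz_sum (R : comUnitRingType) (x : R) (I : finType)
    (C : pred I) (f : I -> int) :
  x \is a GRing.unit -> \prod_(i | C i) x ^ f i = x ^ (\sum_(i | C i) f i).
Proof.
move=> ux; rewrite (big_morph (exprz x) (id1 := 1) (op1 := *%R)) //.
by move=> a b; rewrite exprzDr.
Qed.

Lemma prod_exprz (R : comUnitRingType) (I : eqType) (r : seq I) (C : pred I)
    (F : I -> R) (d : int) :
  (forall i, F i \is a GRing.unit) ->
  \prod_(i <- r | C i) F i ^ d = (\prod_(i <- r | C i) F i) ^ d.
Proof.
move=> uF; elim: r => [|i r IHr]; first by rewrite !big_nil exp1rz.
rewrite !big_cons; case: ifP => // _; rewrite IHr exprMz_comm //.
  by apply: rpred_prod.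
exact: mulrC.
Qed.

Lemma prod_Zred m n (C : pred {set 'I_(m + n)}) :
  \prod_(T | C T) Zred Q T =
  \prod_(1 <= i < m + n) \prod_(i <= j < m + n)
    M (Qpath Q i j) ^ (\sum_(T | C T) \prod_(i <= l < j.+1) tau T l).
Proof.
rewrite exchange_big /=; apply: eq_bigr => i _.
rewrite exchange_big /=; apply: eq_bigr => j _.
by rewrite prod_exprz_sum // M_unit.
Qed.

(** The sum for the one-edge path [e_1] stands for the common value over all the
    paths; it is meaningful only if there is an interior edge. *)
Definition edge_sum m n : int :=
  \sum_(T : {set 'I_(m + n)} | #|T| == m) tau T 1.

Lemma edge_sumE m n (x y : 'I_(m + n)) : x != y ->
  edge_sum m n = pair_sum m x y.
Proof.
move=> xy.
have N1 : (1 < m + n)%N.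
  move: x y xy; case: (m + n)%N => [|[|//]]; first by case.
  by move=> x y; rewrite !ord1.
have N0 := ltnW N1.
rewrite (@pair_sum_const _ m x y (Ordinal N0) (Ordinal N1)) //.
apply: eq_bigr => T _; rewrite -prod_tau //=.
by rewrite big_nat1.
Qed.

Lemma path_sumE m n i j : (1 <= i <= j)%N -> (j < m + n)%N ->
  \sum_(T : {set 'I_(m + n)} | #|T| == m) \prod_(i <= l < j.+1) tau T l =
  edge_sum m n.
Proof.
case: i => // i; rewrite ltnS => /= ij jN; have iN := ltn_trans ij jN.
rewrite (@edge_sumE _ _ (Ordinal iN) (Ordinal jN)); last first.
  by rewrite -val_eqE /= ltn_eqF.
by apply: eq_bigr => T _; rewrite -prod_tau.
Qed.

Lemma ZtotE m n :
  Ztot Q m n =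
  \prod_(1 <= i < m + n) \prod_(i <= j < m + n)
    M (Qpath Q i j) ^ edge_sum m n.
Proof.
rewrite /Ztot prod_Zred.
rewrite big_nat_cond [RHS]big_nat_cond; apply: eq_bigr => i /andP[/andP[i0 _] _].
rewrite big_nat_cond [RHS]big_nat_cond; apply: eq_bigr => j /andP[/andP[ij jN] _].
by rewrite path_sumE // i0.
Qed.

End Products.

(** * Homogeneity *)

Lemma edge_sum_degree m n : (2 <= m + n)%N -> (edge_sum m n)%:~R = degree m n.
Proof.
move=> N2.
have [x [y xy]] : exists x y : 'I_(m + n), x != y.
  by exists (Ordinal (ltnW N2)), (Ordinal N2).
rewrite (edge_sumE xy).
have := pair_sum_eq m xy; rewrite card_ord.
move: (pair_sum m x y) => S /(congr1 (fun z : int => z%:~R : rat)).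
(* Rewriting the binomial coefficient by factorials over [rat] leaves a field
   identity. *)
have /(congr1 (fun k => k%:R : rat)) := bin_fact (leq_addr n m); rewrite addKn.
rewrite /degree; set C := 'C(_, _).
have -> : (m + n)`! = ((m + n) * (m + n).-1 * (m + n - 2)`!)%N.
  by case: (m + n)%N N2 => [|[|N]] // _; rewrite !factS subn2 mulnA.
have m0 : m`!%:R != 0 :> rat by rewrite pnatr_eq0 -lt0n fact_gt0.
have n0 : n`!%:R != 0 :> rat by rewrite pnatr_eq0 -lt0n fact_gt0.
have N0 : ((m + n) * (m + n).-1)%:R != 0 :> rat.
  by rewrite pnatr_eq0; case: (m + n)%N N2 => [|[|N]].
rewrite !natrM in N0 *.
have NE : (m + n)%:R = m%:R + n%:R :> rat by rewrite natrD.
have N'E : (m + n).-1%:R = m%:R + n%:R - 1 :> rat.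
  by rewrite -subn1 natrB ?NE // ltnW.
rewrite !(rmorphM, rmorphB, rmorphXn) /= -!pmulrn ?natrM.
rewrite !NE !N'E in N0 *.
move=> CE SE; apply: (mulfI N0); apply: (mulIf (mulf_neq0 m0 n0)).
rewrite SE mulrAC CE.
by field; rewrite m0 n0.
Qed.

Lemma Qpath_ord (A : comNzRingType) (Q : nat -> A) r (i j : 'I_r) :
  Qpath Q i.+1 j.+1 = \prod_(l in [set l : 'I_r | (i <= l <= j)%N]) Q l.+1.
Proof.
rewrite /Qpath big_add1 (big_nat_widen _ _ r); last exact: ltn_ord.
rewrite big_geq_mkord.
by apply: eq_bigl => l; rewrite inE ltnS andbC.
Qed.

(** The collection of index sets is the set of all intervals. *)
Lemma homogeneous_Ztot (A : comNzRingType) (Q : nat -> A) m n :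
  @homogeneous A (m + n).-1 Q (edge_sum m n) (Ztot Q m n).
Proof.
rewrite ZtotE; move: (edge_sum m n) => d.
case: (m + n)%N => [|r]; rewrite /homogeneous /=.
  by exists set0; rewrite big_set0 exp1rz !big_geq.
pose itv (p : 'I_r * 'I_r) := [set l : 'I_r | (p.1 <= l <= p.2)%N].
exists (itv @: [set p : 'I_r * 'I_r | (p.1 <= p.2)%N]).
rewrite -prod_exprz => [|B]; last exact: M_unit.
rewrite big_imset /=; last first.
  move=> [i j] [i' j']; rewrite !inE /= => ij ij' /setP E.
  have := (E i, E j, E i', E j'); rewrite !inE /= => -[[[Ei Ej] Ei'] Ej'].
  by congr pair; apply/val_inj => /=; lia.
rewrite (eq_bigl (fun p : 'I_r * 'I_r => p.1 <= p.2)%N) => [|p]; last by rewrite inE.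
rewrite big_add1 big_mkord -(pair_big_dep xpredT (fun i j : 'I_r => (i <= j)%N)
  (fun i j => M (\prod_(l in itv (i, j)) Q l.+1) ^ d)) /=.
apply: eq_bigr => i _; rewrite big_add1 big_geq_mkord.
by apply: eq_bigr => j _; rewrite -Qpath_ord.
Qed.

(** * Independent choices in the blocks of a partition *)

(** A subset amounts to an independent choice of its traces on the blocks, so the
    sum over subsets with traces of prescribed sizes expands a product of sums,
    one for each block; only the sum for the block [k] has a nontrivial summand. *)
Lemma sum_blocks (U : finType) P (B : 'I_P -> {set U}) (r : 'I_P -> nat)
    (k : 'I_P) (F : {set U} -> int) :
  (forall x, exists l, forall l', (x \in B l') = (l' == l)) ->
  \sum_(T : {set U} | [forall l, #|T :&: B l| == r l]) F (T :&: B k) =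
  (\prod_(l | l != k) 'C(#|B l|, r l))%N%:Z *
  \sum_(A : {set U} | (A \subset B k) && (#|A| == r k)) F A.
Proof.
move=> BP.
have trace (f : {ffun 'I_P -> {set U}}) l :
    (forall l', f l' \subset B l') -> (\bigcup_l' f l') :&: B l = f l.
  move=> fB; apply/setP => x; rewrite inE; apply/andP/idP => [[]|xf]; last first.
    by split; [apply/bigcupP; exists l | apply: (subsetP (fB l))].
  case/bigcupP => l' _ xf; have xB := subsetP (fB l') _ xf.
  by have [l0 xE] := BP x; move: xB xf; rewrite !xE => /eqP-> xf /eqP->.
pose fam (l : 'I_P) : pred {set U} := fun A => (A \subset B l) && (#|A| == r l).
rewrite (reindex_onto (fun f : {ffun 'I_P -> {set U}} => \bigcup_l f l)
                      (fun T => [ffun l => T :&: B l])) /=; last first.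
  move=> T _; apply/setP => x; apply/bigcupP/idP => [[l _]|xT].
    by rewrite ffunE inE => /andP[].
  by have [l xE] := BP x; exists l => //; rewrite ffunE inE xT xE eqxx.
transitivity (\sum_(f in family fam) \prod_l (if l == k then F (f l) else 1)).
  apply: eq_big => [f | f /andP[_ /eqP <-]]; last first.
    rewrite [RHS](bigD1 k) //= eqxx [X in _ * X]big1 ?mulr1 => [|l /negbTE -> //].
    rewrite trace ?ffunE // => l; rewrite ffunE; exact: subsetIr.
  apply/andP/familyP => [[/forallP fr /eqP fE] l | fP].
    by rewrite -fE ffunE unfold_in subsetIr fr.
  have fB l : f l \subset B l by case/andP: (fP l).
  split; last by apply/eqP/ffunP => l; rewrite ffunE trace.
  by apply/forallP => l; rewrite trace //; case/andP: (fP l).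
rewrite -(bigA_distr_big_dep _ (fun l A => if l == k then F A else 1)) /=.
rewrite (bigD1 k) //= eqxx mulrC; congr (_ * _).
rewrite -natz natr_prod; apply: eq_bigr => l /negbTE ->.
rewrite sumr_const -cards_draws; congr _%:R.
by apply: eq_card => A; rewrite inE.
Qed.

(** * Cutting an interval of integers into consecutive pieces *)

Section Pieces.
Variables (c : nat -> nat) (P : nat).
Hypotheses (c0 : c 0 = 0%N) (c_mono : forall k, (c k <= c k.+1)%N).

Lemma piece_unique t : (t < c P)%N ->
  exists l : 'I_P, forall l' : 'I_P, (c l' <= t < c l'.+1)%N = (l' == l).
Proof.
have cW := homo_leq leqnn leq_trans c_mono.
move=> tP.
have [l lP lt] : exists2 l, (l < P)%N & (c l <= t < c l.+1)%N.
  elim: P tP => [|p IHp]; first by rewrite c0.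
  case: (ltnP t (c p)) => [/IHp[l lp lt] _ | pt tp]; last by exists p; rewrite ?pt.
  by exists l => //; rewrite ltnS ltnW.
exists (Ordinal lP) => l'; apply/idP/eqP => [lt' | -> //].
apply/val_inj => /=; case: (ltngtP l' l) => // ll.
  by have := cW _ _ ll; lia.
by have := cW _ _ ll; lia.
Qed.

(** If [i - 1] lies in the [l]-th piece, then [c l.+1] is the first cut that the
    interval [i, j] can contain.  So either it contains no interior cut and
    belongs to the [l]-th piece alone, or it belongs to no piece. *)
Lemma prod_pieces (R : comNzRingType) (G : nat -> nat -> R) :
  \prod_(1 <= i < c P)
    \prod_(i <= j < c P | ~~ has (fun k => i <= c k <= j)%N (iota 1 P.-1)) G i j =
  \prod_(k < P) \prod_(1 <= i < c k.+1 - c k) \prod_(i <= j < c k.+1 - c k)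
    G (c k + i)%N (c k + j)%N.
Proof.
have cW := homo_leq leqnn leq_trans c_mono.
transitivity (\prod_(k < P) \prod_(1 <= i < c P) \prod_(i <= j < c P)
    (if (c k < i <= j)%N && (j < c k.+1)%N then G i j else 1)).
  rewrite exchange_big /= big_nat_cond [RHS]big_nat_cond.
  apply: eq_bigr => i /andP[/andP[i0 iP] _].
  rewrite exchange_big /= big_mkcond big_nat_cond [RHS]big_nat_cond.
  apply: eq_bigr => j /andP[/andP[ij jP] _].
  have [l lE] : exists l : 'I_P, forall l' : 'I_P,
      (c l' <= i.-1 < c l'.+1)%N = (l' == l) by apply: piece_unique; lia.
  have /andP[li il] : (c l <= i.-1 < c l.+1)%N by rewrite lE.
  rewrite (bigD1 l) //= [X in _ * X]big1 => [|k /negP kl]; last first.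
    by case: ifP => // /andP[/andP[ki _] jk]; case: kl; rewrite -lE; lia.
  rewrite mulr1.
  suff -> : has (fun k => i <= c k <= j)%N (iota 1 P.-1) = (c l.+1 <= j)%N.
    have -> : (c l < i <= j)%N by lia.
    by rewrite -ltnNge.
  apply/hasP/idP => [[k] | lj].
    rewrite mem_iota => kP /andP[ik kj]; apply: leq_trans kj.
    by apply: (cW _ _); case: (ltnP l k) => // /cW; lia.
  exists l.+1; last by lia.
  have : l.+1 != P by apply: contraTneq lj => ->; lia.
  by rewrite mem_iota; have := ltn_ord l; lia.
apply: eq_bigr => k _; have kP : (c k.+1 <= c P)%N by apply: cW.
have shift (H : nat -> R) i :
    \prod_(i + c k <= j < c k.+1) H j =
    \prod_(i <= j < c k.+1 - c k) H (c k + j)%N.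
  by rewrite big_addn; apply: eq_bigr => j _; rewrite addnC.
under [RHS]eq_bigr => i _ do rewrite -shift addnC.
rewrite -(shift (fun i => \prod_(i <= j < c k.+1) G i j)) add1n.
rewrite [RHS](big_nat_widenl _ 1%N) // [RHS](big_nat_widen _ _ (c P)) //.
rewrite [RHS]big_mkcond /=; apply: eq_bigr => i _; rewrite andbC; case: ifP => ik.
  rewrite [RHS](big_nat_widen _ _ (c P)) // [RHS]big_mkcond /=.
  rewrite big_nat_cond [RHS]big_nat_cond.
  by apply: eq_bigr => j /andP[/andP[ij _] _]; case: ifP; case: ifP => //; lia.
rewrite big_nat_cond big1 // => j /andP[/andP[ij _] _].
by case: ifP => //; lia.
Qed.

End Pieces.

(** * The cuts of the strip *)

Section Cuts.
Variables (m n : nat) (E : {set 'I_m.+1 * 'I_n.+1}).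
Hypothesis diagE : toric_diagram E.

Definition cut k : ledge := nth (0, 0)%N (cuts E) k.
Local Notation P := (npieces E).

Definition sorted_edges : seq ledge :=
  sort (fun e f : ledge => (e.1 + e.2 <= f.1 + f.2)%N)
       [seq lattice_edge e | e <- enum E].

Lemma cutS k : (k < #|E|)%N -> cut k.+1 = nth (0, 0)%N sorted_edges k.
Proof.
by move=> kE; rewrite /cut /= nth_rcons size_sort size_map -cardE kE.
Qed.

Lemma size_sorted_edges : size sorted_edges = #|E|.
Proof. by rewrite size_sort size_map -cardE. Qed.

Lemma mem_sorted_edges e :
  reflect (exists2 f, f \in E & e = lattice_edge f) (e \in sorted_edges).
Proof.
rewrite mem_sort; apply: (iffP mapP) => -[f fE ->]; exists f => //.
  by rewrite mem_enum in fE.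
by rewrite mem_enum.
Qed.

Lemma cut_last : cut P = (m, n).
Proof. by rewrite /cut /npieces /= nth_rcons size_sorted_edges ltnn eqxx. Qed.

Lemma mem_cut e :
  reflect (exists2 f, f \in E & e = lattice_edge f)
          [exists k : 'I_P, (0 < k)%N && (cut k == e)].
Proof.
apply: (iffP idP) => [/existsP[[[|k] kP] /andP[//= _ /eqP <-]] | ].
  have kE : (k < #|E|)%N by [].
  by apply/mem_sorted_edges; rewrite cutS // mem_nth // size_sorted_edges.
move=> /mem_sorted_edges/(nthP (0, 0)%N)[k kE eE].
rewrite size_sorted_edges in kE; apply/existsP.
have kP : (k.+1 < P)%N by [].
by exists (Ordinal kP); rewrite /= cutS // eE.
Qed.

(** Of two edges that do not cross, the one with the smaller sum of abscissas is
    weakly to the left of the other on both lines. *)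
Lemma noncrossing_le (e f : ledge) : ~~ crossing e f ->
  (e.1 + e.2 <= f.1 + f.2)%N -> (e.1 <= f.1)%N && (e.2 <= f.2)%N.
Proof. by rewrite /crossing; lia. Qed.

Lemma lattice_edge_le (e : 'I_m.+1 * 'I_n.+1) :
  ((lattice_edge e).1 <= m)%N && ((lattice_edge e).2 <= n)%N.
Proof. by rewrite /= !leq_ord. Qed.

Lemma cut_mono k : (k < P)%N ->
  ((cut k).1 <= (cut k.+1).1)%N && ((cut k).2 <= (cut k.+1).2)%N.
Proof.
case: k => [|k] //; rewrite /npieces ltnS => kE.
have cutE l : (l < #|E|)%N -> exists2 f, f \in E & cut l.+1 = lattice_edge f.
  by move=> lE; apply/mem_sorted_edges; rewrite cutS // mem_nth // size_sorted_edges.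
have [f fE kf] := cutE k kE; rewrite kf.
move: (kE); rewrite leq_eqVlt => /predU1P[kE' | kE'].
  by rewrite kE' -/(npieces E) cut_last lattice_edge_le.
have [g gE kg] := cutE _ kE'; rewrite kg.
apply: noncrossing_le; first exact: diagE.2.
rewrite -kf -kg !cutS //.
have /(sortedP (0, 0)%N) := @sort_sorted _ (fun e f : ledge =>
  (e.1 + e.2 <= f.1 + f.2)%N) (fun e f => leq_total _ _)
  [seq lattice_edge e | e <- enum E].
by apply; rewrite size_sorted_edges.
Qed.

Lemma NsumS k : Nsum E k.+1 = (Nsum E k + (mtop E k + nbot E k))%N.
Proof. by rewrite /Nsum big_ord_recr. Qed.

Lemma Nsum0 : Nsum E 0 = 0%N.
Proof. by rewrite /Nsum big_ord0. Qed.

Lemma Nsum_mono k : (Nsum E k <= Nsum E k.+1)%N.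
Proof. by rewrite NsumS leq_addr. Qed.

Lemma NsumE k : (k <= P)%N -> Nsum E k = ((cut k).1 + (cut k).2)%N.
Proof.
elim: k => [_|k IHk kP]; first by rewrite Nsum0.
rewrite NsumS IHk 1?ltnW // /mtop /nbot -/(cut k) -/(cut k.+1).
by have := cut_mono kP; lia.
Qed.

Lemma Nsum_last : Nsum E P = (m + n)%N.
Proof. by rewrite NsumE // cut_last. Qed.

(** * Triangulations containing the filled edges *)

Definition piece (l : nat) : {set 'I_(m + n)} :=
  [set t : 'I_(m + n) | (Nsum E l <= t < Nsum E l.+1)%N].

Lemma piece_partition (t : 'I_(m + n)) :
  exists l : 'I_P, forall l' : 'I_P, (t \in piece l') = (l' == l).
Proof.
have [l lE] := @piece_unique (Nsum E) P Nsum0 Nsum_mono t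
  (eq_ind_r (fun N => t < N)%N (ltn_ord t) Nsum_last).
by exists l => l'; rewrite inE.
Qed.


Definition below (T : {set 'I_(m + n)}) (i : nat) : nat :=
  #|[set t in T | (t < i)%N]|.

Lemma below_sum (T : {set 'I_(m + n)}) i : (i <= m + n)%N ->
  (below T i + below (~: T) i)%N = i.
Proof.
move=> iN.
transitivity #|[set t : 'I_(m + n) | (t < i)%N]|.
  rewrite -[RHS](cardsID T); congr (_ + _)%N; apply: eq_card => t.
    by rewrite !inE andbC.
  by rewrite !inE.
rewrite -sum1_card (eq_bigl _ _ (fun t => in_set _ t)).
by rewrite -(big_ord_widen _ (fun=> 1%N)) // sum1_card card_ord.
Qed.

Lemma below_piece (T : {set 'I_(m + n)}) l :
  below T (Nsum E l.+1) =
  (below T (Nsum E l) + #|T :&: piece l|)%N.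
Proof.
rewrite /below -(cardsID [set t : 'I_(m + n) | (t < Nsum E l)%N]).
have le_l := Nsum_mono l.
congr (_ + _)%N; apply: eq_card => t; rewrite !inE.
  by case: (t \in T) => //=; lia.
by case: (t \in T) => //=; lia.
Qed.

Lemma below_total (T : {set 'I_(m + n)}) : below T (m + n)%N = #|T|.
Proof. by apply: eq_card => t; rewrite !inE ltn_ord andbT. Qed.

Lemma contains_edgeE (T : {set 'I_(m + n)}) (e : 'I_m.+1 * 'I_n.+1) :
  lattice_edge e != (0, 0)%N -> lattice_edge e != (m, n) ->
  contains_edge T (lattice_edge e) =
  (below T ((lattice_edge e).1 + (lattice_edge e).2)%N
     == (lattice_edge e).1).
Proof.
have := lattice_edge_le e; case: (lattice_edge e) => a b /= /andP[am bn] /eqP e0 /eqP e1.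
have s0 : (0 < a + b)%N.
  rewrite lt0n addn_eq0; apply/negP => /andP[/eqP a0 /eqP b0].
  by apply: e0; congr pair.
have sN : (a + b < m + n)%N.
  rewrite ltnNge; apply/negP => ge; apply: e1; congr pair; lia.
(* The edge [e_i] of [T] ends at abscissas with sum [i], so only the interior
   edge of index [a + b] can be the segment from [(a, 1)] to [(b, 0)]. *)
have tri_edgeE i : tri_edge T i = (below T i, below (~: T) i) by [].
apply/existsP/eqP => [[i /andP[_ /eqP]] | aE].
  by rewrite tri_edgeE => -[<- <-]; rewrite below_sum // ltnW.
exists (Ordinal sN); rewrite s0 tri_edgeE /= aE; apply/eqP; congr pair.
by apply: (@addnI a); rewrite -{1}aE below_sum // ltnW.
Qed.

(** A triangulation resolves [X] exactly when it restricts to a triangulation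
    of each piece: the filled edges are cut out at the right abscissas if and
    only if the pieces have top sides of the right lengths. *)
Lemma resolvesE (T : {set 'I_(m + n)}) :
  (#|T| == m) && resolves E T =
  [forall l : 'I_P, #|T :&: piece l| == mtop E l].
Proof.
have mtopE k : mtop E k = ((cut k.+1).1 - (cut k).1)%N by [].
have cut1 k : (k < P)%N -> ((cut k).1 <= (cut k.+1).1)%N.
  by case/cut_mono/andP.
(* Both sides prescribe the number of triangles with base on the top line to the
   left of each cut, the left and right sides of the strip included. *)
transitivity [forall k : 'I_P.+1, below T (Nsum E k) == (cut k).1].
  apply/andP/forallP => [[/eqP Tm /forallP Tres] [k] /= | H].
    rewrite ltnS leq_eqVlt => /predU1P[-> | kP].
      by rewrite Nsum_last cut_last below_total Tm.
    case: k kP => [|k] kP.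
      by rewrite Nsum0 cards_eq0; apply/eqP/setP => t; rewrite !inE andbF.
    have /(mem_cut _)[f fE kf] : [exists j : 'I_P, (0 < j)%N && (cut j == cut k.+1)].
      by apply/existsP; exists (Ordinal kP); rewrite /= eqxx.
    rewrite NsumE 1?ltnW // kf; have [f0 f1] := diagE.1 f fE.
    by move: (Tres f); rewrite fE /= contains_edgeE.
  split.
    by have := H ord_max; rewrite /= Nsum_last cut_last below_total.
  apply/forallP => e; apply/implyP => eE; have [e0 e1] := diagE.1 e eE.
  have /existsP[k /andP[_ /eqP ke]] :
      [exists k : 'I_P, (0 < k)%N && (cut k == lattice_edge e)].
    by apply/mem_cut; exists e.
  rewrite contains_edgeE // -ke -NsumE; last exact: ltnW.
  by have := H (widen_ord (leqnSn P) k).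
apply/forallP/forallP => [H l | H [k kP]] /=.
  have Hl := eqP (H (widen_ord (leqnSn P) l)).
  have Hl' := eqP (H (lift ord0 l)).
  move: Hl Hl'; rewrite /= /bump add1n below_piece mtopE => -> <-.
  by rewrite addKn.
elim: k kP => [_|k IHk kP].
  by rewrite Nsum0 cards_eq0; apply/eqP/setP => t; rewrite !inE andbF.
have kP' : (k < P)%N by [].
rewrite below_piece (eqP (IHk (ltnW kP))) (eqP (H (Ordinal kP'))) mtopE.
by rewrite subnKC // cut1.
Qed.

(** * Exponents of the factors of the total partition function of [X] *)

Lemma piece_ltn (k : 'I_P) (i : 'I_(mtop E k + nbot E k)) :
  (Nsum E k + i < m + n)%N.
Proof.
rewrite -Nsum_last; apply: (@leq_trans (Nsum E k.+1)).
  by rewrite NsumS ltn_add2l.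
exact: (homo_leq leqnn leq_trans Nsum_mono).
Qed.

Definition piece_inj (k : 'I_P) (i : 'I_(mtop E k + nbot E k)) : 'I_(m + n) :=
  Ordinal (piece_ltn i).

Lemma piece_inj_inj k : injective (@piece_inj k).
Proof. by move=> i j /(congr1 val)/addnI/val_inj. Qed.

Lemma piece_image (k : 'I_P) : @piece_inj k @: setT = piece k.
Proof.
apply/setP => t; rewrite inE NsumS; apply/imsetP/idP => [[i _ ->] | tk] /=.
  by rewrite leq_addr ltn_add2l ltn_ord.
have ti : (t - Nsum E k < mtop E k + nbot E k)%N by lia.
by exists (Ordinal ti); rewrite ?inE //; apply/val_inj => /=; lia.
Qed.

Lemma card_piece (k : 'I_P) : #|piece k| = (mtop E k + nbot E k)%N.
Proof.
by rewrite -piece_image card_imset ?cardsT ?card_ord //; exact: piece_inj_inj.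
Qed.

Definition resolution_sum (i j : nat) : int :=
  \sum_(T : {set 'I_(m + n)} | (#|T| == m) && resolves E T)
    \prod_(i <= l < j.+1) tau T l.

(** Both triangles at the ends of a path inside a piece belong to that piece, so
    the sign of the path depends only on the trace of the triangulation there. *)
Lemma resolution_sum_piece (k : 'I_P) i j :
  (1 <= i <= j)%N -> (j < mtop E k + nbot E k)%N ->
  resolution_sum (Nsum E k + i) (Nsum E k + j) =
  edge_sum (mtop E k) (nbot E k) * (bexp k)%:Z.
Proof.
case: i => // i; rewrite ltnS => /= ij jN; have iN := ltn_trans ij jN.
pose x := Ordinal iN; pose y := Ordinal jN.
have xy : x != y by rewrite -val_eqE /= ltn_eqF.
have inP (z : 'I_(mtop E k + nbot E k)) : piece_inj z \in piece k.
  by rewrite -piece_image imset_f ?inE.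
rewrite (edge_sumE xy) -(pair_sum_imset _ _ _ (@piece_inj_inj k)) piece_image.
transitivity (
  \sum_(T : {set 'I_(m + n)} | [forall l : 'I_P, #|T :&: piece l| == mtop E l])
   side (T :&: piece k) (piece_inj x) * side (T :&: piece k) (piece_inj y)).
  apply: eq_big => [T | T _]; first exact: resolvesE.
  rewrite addnS (@prod_tau _ T (piece_inj x) (piece_inj y)) /= ?ltn_add2l //.
  by rewrite /side !in_setI !inP !andbT.
rewrite (@sum_blocks _ _ (fun l : 'I_P => piece l) (fun l => mtop E l) k
  (fun A => side A (piece_inj x) * side A (piece_inj y)) piece_partition).
rewrite mulrC; congr (_ * Posz _); apply: eq_bigr => l _.
by rewrite card_piece -bin_sub ?leq_addr // addKn.
Qed.

End Cuts.

(** * The factorization *)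

Lemma Qpath_shift (A : comNzRingType) (Q : nat -> A) c i j :
  Qpath (fun l => Q (c + l)%N) i j = Qpath Q (c + i) (c + j).
Proof.
rewrite /Qpath [in RHS]addnC big_addn -addnS addKn.
by apply: eq_bigr => l _; rewrite addnC.
Qed.

Lemma ZtotX_factor (A : comNzRingType) (Q : nat -> A) m n
    (E : {set 'I_m.+1 * 'I_n.+1}) : toric_diagram E ->
  ZtotX E Q =
  (\prod_(1 <= i < m + n) \prod_(i <= j < m + n | crosses E i j)
     M (Qpath Q i j) ^ resolution_sum E i j) *
  \prod_(k < npieces E)
    Ztot (fun i => Q (Nsum E k + i)%N) (mtop E k) (nbot E k) ^+ bexp k.
Proof.
move=> diagE; pose G i j := M (Qpath Q i j) ^ resolution_sum E i j.
have -> : ZtotX E Q = \prod_(1 <= i < m + n) \prod_(i <= j < m + n) G i j.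
  exact: prod_Zred.
under eq_bigr => i _ do rewrite (bigID (crosses E i)) /=.
rewrite big_split /=; congr (_ * _).
rewrite -(Nsum_last diagE) (prod_pieces _ (Nsum0 E) (Nsum_mono E)).
apply: eq_bigr => k _.
rewrite ZtotE -!prodrXl; have -> : (Nsum E k.+1 - Nsum E k = mtop E k + nbot E k)%N.
  by rewrite NsumS addKn.
rewrite big_nat_cond [RHS]big_nat_cond; apply: eq_bigr => i /andP[/andP[i0 _] _].
rewrite -prodrXl big_nat_cond [RHS]big_nat_cond.
apply: eq_bigr => j /andP[/andP[ij jN] _].
rewrite /G resolution_sum_piece ?i0 // Qpath_shift.
by rewrite -[X in X ^+ _]/(_ ^ _) -exprz_exp.
Qed.

Theorem corollary5p9 (m n : nat) (E : {set 'I_m.+1 * 'I_n.+1})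
    (Q := Qvar (m + n).-1) (P := npieces E)
    (mn_neq0 : (m, n) != (0, 0)%N)
    (diagE : toric_diagram E)
    (singE : singular_diagram E) :
  exists Z'' : fps {mpoly int[(m + n).-1]},
  [/\ ZtotX E Q =
        Z'' * \prod_(k < P)
          Ztot (fun i => Q (Nsum E k + i)%N) (mtop E k) (nbot E k) ^+ bexp k,
      forall k : 'I_P, (2 <= mtop E k + nbot E k)%N ->
        exists2 d : int,
          d%:~R = degree (mtop E k) (nbot E k) &
          @homogeneous _ (mtop E k + nbot E k).-1
            (fun i => Q (Nsum E k + i)%N) d
            (Ztot (fun i => Q (Nsum E k + i)%N) (mtop E k) (nbot E k))
    & exists c : nat -> nat -> int,
        Z'' = \prod_(1 <= i < m + n)
                \prod_(i <= j < m + n | crosses E i j)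
                  M (Qpath Q i j) ^ c i j].
Proof.
exists (\prod_(1 <= i < m + n) \prod_(i <= j < m + n | crosses E i j)
          M (Qpath Q i j) ^ resolution_sum E i j).
split; first exact: ZtotX_factor.
  move=> k N2; exists (edge_sum (mtop E k) (nbot E k)).
    exact: edge_sum_degree.
  exact: homogeneous_Ztot.
by exists (resolution_sum E).
Qed.
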